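(* Let $\mathbb{X}$ be a real Hilbert space with dual $\mathbb{X}^*$ and let $j:\mathbb{X}\to\mathbb{R}$ be a functional. Assume that $j$ is Gâteaux differentiable and that its derivative $j':\mathbb{X}\to\mathbb{X}^*$ is Lipschitz continuous, i.e., there is a constant $L>0$ such that $$\|j'(\xi)-j'(\eta)\|_{\mathbb{X}^*}\le L\,\|\xi-\eta\|_{\mathbb{X}},\qquad\forall \xi,\eta\in\mathbb{X}.$$ Furthermore, assume that $j$ is strongly convex, i.e., there is a constant $\gamma>0$ such that $$\langle j'(\xi)-j'(\eta),\,\xi-\eta\rangle_{\mathbb{X}^*,\mathbb{X}}\ge\gamma\,\|\xi-\eta\|_{\mathbb{X}}^2,\qquad\forall\xi,\eta\in\mathbb{X}.$$ Then the following hold true: (i) $j$ has a unique minimizer $\bar\xi\in\mathbb{X}$, and it satisfies $j'(\bar\xi)=0$ in $\mathbb{X}^*$. (ii) For any nonempty subset $\mathcal{M}_n\subset\mathbb{X}$ and any $\delta_n>0$, $j$ has a quasi-minimizer in $\mathcal{M}_n$, i.e., there exists $\bar\xi_n\in\mathcal{M}_n$ such that $$j(\bar\xi_n)\le\inf_{\xi_n\in\mathcal{M}_n}j(\xi_n)+\frac{\delta_n}{2}.$$ (iii) Any such quasi-minimizer $\bar\xi_n\in\mathcal{M}_n$ satisfies the quasi-optimal error estimate $$\|\bar\xi-\bar\xi_n\|_{\mathbb{X}}\le\left(\frac{L}{\gamma}\inf_{\xi_n\in\mathcal{M}_n}\|\bar\xi-\xi_n\|_{\mathbb{X}}^2+\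frac{\delta_n}{\gamma}\right)^{1/2}.$$
   Context: The subset $\mathcal{M}_n$ is arbitrary: it need not be closed, convex or a linear subspace (the index $n$ is only a label; in applications $\mathcal{M}_n$ is a set of functions realized by neural networks of a fixed architecture). A functional or map $G$ is Gâteaux differentiable at $\xi$ if for every direction $\eta$ the limit $G'(\xi)\eta=\lim_{t\to0}(G(\xi+t\eta)-G(\xi))/t$ exists and $\eta\mapsto G'(\xi)\eta$ is linear and continuous; it is Gâteaux differentiable if this holds at every $\xi$. *)

(* Defs.v *)
From HB Require Import structures.
From mathcomp Require Import all_boot all_order all_algebra.
From mathcomp Require Import all_classical all_reals all_analysis.

Set Implicit Arguments.
Unset Strict Implicit.
Unset Printing Implicit Defensive.

Import Order.TTheory GRing.Theory Num.Theory.
Import numFieldNormedType.Exports.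

Local Open Scope classical_set_scope.
Local Open Scope ring_scope.

(* A real Hilbert space is a complete normed module whose norm comes from an
   inner product; {dot X for idfun} is the type of positive definite symmetric
   bilinear forms on X. *)
Definition induces_norm (R : realType) (X : normedModType R)
    (dotp : {dot X for @idfun R}) : Prop :=
  forall x : X, `|x| ^+ 2 = dotp x x.

(* The continuous dual, carved out of the functions X -> R; the pairing
   <f, x> is application. *)
Definition dual (R : realType) (X : normedModType R) : set (X -> R) :=
  [set f | linear f /\ continuous f].

(* On the dual the supremum is finite; outside of it the value may be junk. *)
Definition dual_norm (R : realType) (X : normedModType R) (f : X -> R) : R :=
  sup [set `|f x| | x in [set x : X | `|x| <= 1]].

Definition gateaux_derive (R : realType) (X : normedModType R) (j : X -> R)
    (xi : X) : X -> R :=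
  fun eta => 'D_eta j xi.

Definition gateaux_differentiable (R : realType) (X : normedModType R)
    (j : X -> R) : Prop :=
  forall xi : X,
    (forall eta : X, derivable j xi eta) /\ dual (gateaux_derive j xi).

Definition minimizer (R : realType) (X : normedModType R) (j : X -> R)
    (xi : X) : Prop :=
  forall eta : X, j xi <= j eta.

(* The infimum is taken in the extended reals, so that it is -oo, rather than
   a default value, when j is unbounded below on M. *)
Definition quasi_minimizer (R : realType) (X : normedModType R) (j : X -> R)
    (M : set X) (delta : R) (xi : X) : Prop :=
  M xi /\
  ((j xi)%:E <= ereal_inf [set (j eta)%:E | eta in M] + (delta / 2)%:E)%E.

(* Main.v *)
(* Integrating the two hypotheses along segments sandwiches j between quadratics:
     j x + <j' x, y - x> + gamma/2 |y - x|^2 <= j y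
       <= j x + <j' x, y - x> + L/2 |y - x|^2.
   The lower one, applied at a midpoint, makes minimizing sequences Cauchy; the
   tangent at the limit shows that the limit is a minimizer. With j' xibar = 0,
   both bounds centred at xibar compare energy gaps with squared distances,
   which is the error estimate. No Riesz representation is needed. *)
Require Import Defs.
From HB Require Import structures.
From mathcomp Require Import all_boot all_order all_algebra.
From mathcomp Require Import all_classical all_reals all_analysis.
From mathcomp Require Import ring lra.

Set Implicit Arguments.
Unset Strict Implicit.
Unset Printing Implicit Defensive.

Import Order.TTheory GRing.Theory Num.Theory.
Import numFieldNormedType.Exports.

Local Open Scope classical_set_scope.
Local Open Scope ring_scope.

(** * Continuous functionals and the dual norm *)

Section Dual.
Variables (R : realType) (X : normedModType R).
Implicit Types f g : X -> R.

Lemma dual_scale f a x : dual f -> f (a *: x) = a * f x.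
Proof.
move=> [lf _]; have f0 : f 0 = 0.
  by have := lf (-1) 0 0; rewrite scaler0 addr0 scaleN1r addNr.
by have := lf a x 0; rewrite !addr0 f0 addr0.
Qed.

Lemma dualB f g : dual f -> dual g -> dual (f \- g).
Proof.
move=> [lf cf] [lg cg]; split=> [a u v|x] /=.
  by rewrite lf lg scalerBr opprD addrACA.
by apply: cvgB; [exact: cf|exact: cg].
Qed.

(** The real-valued supremum is meaningful only once the set of values is bounded. Continuity at 0
    supplies this bound; then [f] is evaluated at [x] scaled to norm 1. *)
Lemma dual_normP f x : dual f -> `|f x| <= dual_norm f * `|x|.
Proof.
move=> df; have f0 : f 0 = 0 by rewrite -[X in f X](scale0r 0) dual_scale// mul0r.
have [r r0 rf] : exists2 r, 0 < r & forall y, `|y| < r -> `|f y| < 1.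
  have : \forall y \near (0 : X), `|f 0 - f y| < 1.
    exact: cvgr_dist_lt (df.2 0) _ ltr01.
  move=> /nbhs_norm0P[r /= r0 rf]; exists r => // y yr; have := rf y yr.
  by rewrite f0 /= sub0r normrN.
have bnd : has_ubound [set `|f y| | y in [set y : X | `|y| <= 1]].
  (* Scaling by [r / 2] rather than [r] keeps the closed unit ball strictly inside the ball of
     radius [r], where [|f| < 1]. *)
  exists (2 / r) => _ [y /= y1 <-].
  have : `|f ((r / 2) *: y)| < 1.
    apply: rf; rewrite normrZ gtr0_norm ?divr_gt0//.
    apply: le_lt_trans (_ : r / 2 * 1 < r); last by lra.
    by rewrite ler_wpM2l// ltW// divr_gt0.
  rewrite dual_scale// normrM gtr0_norm ?divr_gt0// => /ltW.
  by rewrite -ler_pdivlMl ?divr_gt0// mulr1 invf_div.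
have [->|x0] := eqVneq x 0; first by rewrite f0 !normr0 mulr0.
have nx : 0 < `|x| by rewrite normr_gt0.
rewrite -ler_pdivrMr// mulrC -(normr_id x) -normfV -normrM -dual_scale//.
apply: (ub_le_sup bnd); exists (`|x|^-1 *: x) => //=.
by rewrite normrZ normfV normr_id mulVf// gt_eqF.
Qed.

End Dual.

(** Stands in for integrating [c * t <= dphi t - dphi 0] over [0, 1]: the mean value theorem is
    applied to [phi] minus the quadratic with derivative [dphi 0 + c * t]. *)
Lemma mean_value_quadratic (R : realType) (phi dphi : R -> R) (c : R) :
  (forall t : R, is_derive t 1 phi (dphi t)) ->
  (forall t, 0 < t -> c * t <= dphi t - dphi 0) ->
  c / 2 <= phi 1 - phi 0 - dphi 0.
Proof.
move=> dp cp; pose g t := phi t - (dphi 0 * t + c / 2 * t ^+ 2).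
have dg (t : R) : is_derive t 1 g (dphi t - (dphi 0 + c * t)).
  apply: is_derive_eq.
  by rewrite /GRing.scale /=; field.
have cg : {within `[0, 1], continuous g}.
  by apply: derivable_within_continuous => t _; exact: ex_derive.
have [t t01] := MVT ltr01 (fun t _ => dg t) cg.
rewrite /g subr0 mulr1 !expr0n !expr1n /= !mulr0 !mulr1 => E.
have := cp t; rewrite (itvP t01) => /(_ isT); lra.
Qed.

(** * Quadratic bounds along segments and stationarity *)

Section Functional.
Variables (R : realType) (X : normedModType R) (j : X -> R).
Hypothesis hj : gateaux_differentiable j.
Local Notation D := (gateaux_derive j).

Lemma is_derive_line (x h : X) (t : R) :
  is_derive t 1 (fun s : R => j (x + s *: h)) (D (x + t *: h) h).
Proof.
have E : (fun s : R => s^-1 *: (((fun s => j (x + s *: h)) \o shift t) (s *: 1)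
            - j (x + t *: h)))
       = (fun s : R => s^-1 *: ((j \o shift (x + t *: h)) (s *: h)
            - j (x + t *: h))).
  apply: funext => s /=.
  by rewrite [_ *: 1]mulr1 scalerDl addrCA.
by split; rewrite /derivable /gateaux_derive /derive E//; exact: (hj _).1.
Qed.

(** The factor [t] turns the direction [h] into the displacement [t *: h] between the two base
    points, the form in which strong monotonicity is assumed. *)
Lemma gateaux_line_diff (x h : X) (t : R) :
  t * (D (x + t *: h) h - D (x + 0 *: h) h) = (D (x + t *: h) \- D x) (t *: h).
Proof.
by rewrite scale0r addr0 /= (dual_scale _ _ (hj (x + t *: h)).2)
  (dual_scale _ _ (hj x).2) mulrBr.
Qed.

Lemma quadratic_lower_bound (gamma : R) :
  (forall x y, gamma * `|x - y| ^+ 2 <= (D x \- D y) (x - y)) ->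
  forall x y, j x + D x (y - x) + gamma / 2 * `|y - x| ^+ 2 <= j y.
Proof.
move=> cvx x y; set h := y - x.
have := @mean_value_quadratic _ _ _ (gamma * `|h| ^+ 2) (is_derive_line x h).
rewrite scale1r scale0r addr0 subrKC => H.
suff /H : forall t, 0 < t ->
  gamma * `|h| ^+ 2 * t <= D (x + t *: h) h - D x h by lra.
move=> t t0; rewrite -(ler_pM2l t0).
have := cvx (x + t *: h) x; have := gateaux_line_diff x h t.
rewrite [_ - x]addrC addKr scale0r addr0 => <-; apply: le_trans.
by rewrite normrZ gtr0_norm//; lra.
Qed.

Lemma quadratic_upper_bound (L : R) :
  (forall x y, dual_norm (D x \- D y) <= L * `|x - y|) ->
  forall x y, j y <= j x + D x (y - x) + L / 2 * `|y - x| ^+ 2.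
Proof.
move=> lip x y; set h := y - x.
(* An upper bound on [j] is a lower bound on its negative, hence the sign of the constant. *)
have := @mean_value_quadratic _ _ _ (- (L * `|h| ^+ 2))
  (fun t => is_deriveN (is_derive_line x h t)).
rewrite /= !fctE scale1r scale0r addr0 subrKC => H.
suff /H : forall t, 0 < t ->
  - (L * `|h| ^+ 2) * t <= - D (x + t *: h) h - - D x h by lra.
move=> t t0; rewrite -opprB mulNr lerN2 addrC opprK.
have /= := dual_normP h (dualB (hj (x + t *: h)).2 (hj x).2).
move=> /(le_trans (ler_norm _)) /le_trans; apply.
apply: le_trans (ler_wpM2r (normr_ge0 _) (lip _ _)) _.
by rewrite addrC addKr normrZ gtr0_norm//; lra.
Qed.

Lemma minimizer_gateaux_derive0 (L : R) (xi : X) : 0 < L ->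
  (forall x y, dual_norm (D x \- D y) <= L * `|x - y|) ->
  minimizer j xi -> D xi = (fun=> 0).
Proof.
move=> L0 lip mj; apply: funext => h; set a := D xi h.
have N0 : 0 <= L * `|h| ^+ 2 by rewrite mulr_ge0 ?exprn_ge0 ?normr_ge0 ?ltW.
(* Descent along [- a *: h] with a step short enough that the quadratic term
   does not absorb the linear one. *)
pose t := (L * `|h| ^+ 2 + 1)^-1.
have t0 : 0 < t by rewrite invr_gt0 ltr_wpDl.
have tN : t * (L * `|h| ^+ 2) = 1 - t.
  by rewrite /t; field; rewrite gt_eqF// ltr_wpDl.
have := quadratic_upper_bound lip xi (xi + (- (t * a)) *: h).
rewrite [xi + _]addrC addrK (dual_scale _ _ (hj xi).2).
rewrite -/a normrZ exprMn real_normK ?num_real// => /(le_trans (mj _)).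
(* By [tN] the quadratic term is [t * a ^+ 2 / 2 * (1 - t)], at most half of the linear gain
   [t * a ^+ 2]; minimality then forces [a = 0]. *)
have -> : L / 2 * ((- (t * a)) ^+ 2 * `|h| ^+ 2) =
  t * a ^+ 2 / 2 * (t * (L * `|h| ^+ 2)) by ring.
rewrite tN => ineq.
suff a2 : a ^+ 2 <= 0.
  by apply/eqP; rewrite -sqrf_eq0 eq_le a2 sqr_ge0.
have := sqr_ge0 a; have := ltW t0 => t0' a0.
have : 0 <= t * a ^+ 2 * t by rewrite (mulr_ge0 (mulr_ge0 t0' a0) t0').
move=> a2t; rewrite -(ler_pM2l t0) mulr0; lra.
Qed.

End Functional.

(** * Existence of a minimizer *)

Section Minimizer.
Variables (R : realType) (X : completeNormedModType R) (j : X -> R).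
Hypothesis hj : gateaux_differentiable j.
Local Notation D := (gateaux_derive j).
Variable gamma : R.
Hypothesis gamma_gt0 : 0 < gamma.
Hypothesis j_cvx :
  forall x y, gamma * `|x - y| ^+ 2 <= (D x \- D y) (x - y).

Lemma strongly_convex_has_inf : has_inf (range j).
Proof.
split; first by exists (j 0), 0.
(* The bound is the minimum over real [s] of [j 0 - K * s + gamma / 2 * s ^+ 2], found by completing
   the square. *)
pose K := dual_norm (D 0); exists (j 0 - K ^+ 2 / (2 * gamma)) => _ [y _ <-].
have := quadratic_lower_bound hj j_cvx 0 y; rewrite subr0.
apply: le_trans; rewrite -addrA lerD2l.
have := dual_normP y (hj 0).2; rewrite ler_norml => /andP[Dy _].
have sq : 0 <= (K - gamma * `|y|) ^+ 2 / (2 * gamma).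
  by rewrite divr_ge0 ?sqr_ge0// mulr_ge0// ltW.
have E : (K - gamma * `|y|) ^+ 2 / (2 * gamma) =
  K ^+ 2 / (2 * gamma) - K * `|y| + gamma / 2 * `|y| ^+ 2.
  by field; rewrite gt_eqF.
rewrite -/K in Dy; lra.
Qed.

(** Averages the tangent bounds at the midpoint [m] for [x] and [y]: the linear terms cancel, and
    both distances to [m] are half of [|x - y|], whence [gamma / 8]. *)
Lemma strongly_convex_midpoint x y :
  j (2^-1 *: (x + y)) + gamma / 8 * `|x - y| ^+ 2 <= (j x + j y) / 2.
Proof.
set m := 2^-1 *: (x + y).
have half (u : X) : u = 2^-1 *: u + 2^-1 *: u.
  by rewrite -scalerDl -[LHS]scale1r; congr (_ *: _); field.
have Ex : x - m = 2^-1 *: (x - y).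
  by rewrite {1}[x]half /m scalerDr scalerBr opprD addrACA subrr add0r.
have Ey : y - m = (- 2^-1) *: (x - y).
  rewrite {1}[y]half /m scaleNr scalerDr scalerBr opprD opprB addrACA.
  by rewrite subrr addr0 addrC.
have := quadratic_lower_bound hj j_cvx m x.
have := quadratic_lower_bound hj j_cvx m y.
rewrite Ex Ey !(dual_scale _ _ (hj m).2) !normrZ normrN gtr0_norm ?invr_gt0//.
rewrite !exprMn; lra.
Qed.

Lemma strongly_convex_minimizer : exists xi, minimizer j xi.
Proof.
have hinf := strongly_convex_has_inf; set m := inf (range j).
have mle x : m <= j x by apply: ge_inf; [exact: hinf.2|exists x].
have /choice[u uP] (n : nat) : exists x, j x < m + n.+1%:R^-1.
  have n0 : 0 < n.+1%:R^-1 :> R by rewrite invr_gt0.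
  by have [_ [x _ <-] ?] := inf_adherent n0 hinf; exists x.
have small e : 0 < e -> \forall n \near \oo, j (u n) < m + e.
  move=> e0; near=> n; apply: lt_trans (uP n) _; rewrite ltrD2l.
  near: n; exact: (near_infty_natSinv_lt (PosNum e0)).
have u_cvg : cvg (u @ \oo).
  apply: cauchy_cvg; apply: cauchy_exP => e e0.
  (* With both values below [m + gamma / 8 * e ^+ 2] and the midpoint value at least [m], the
     midpoint inequality yields [|u N - u n| < e]. *)
  have d0 : 0 < gamma / 8 * e ^+ 2 by rewrite mulr_gt0 ?exprn_gt0 ?divr_gt0.
  have [N _ uN] := small _ d0.
  exists (u N); exists N => // n Nn; rewrite -ball_normE /=.
  have := strongly_convex_midpoint (u N) (u n).
  have := uN _ Nn; have := uN _ (leqnn N); have := mle (2^-1 *: (u N + u n)).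
  rewrite /= => h1 h2 h3 h4.
  rewrite -(@ltr_pXn2r _ 2)// ?nnegrE ?normr_ge0 ?ltW//.
  have g0 : 0 < gamma / 8 by rewrite divr_gt0.
  by rewrite -(ltr_pM2l g0); lra.
have /cvg_ex[/= xi u_xi] := u_cvg.
exists xi => y; apply: le_trans (mle y).
(* j is lower semicontinuous at xi, because it lies above its tangent there. *)
apply/ler_addgt0Pr => e e0; have e2 : 0 < e / 2 by rewrite divr_gt0.
have D0 : D xi 0 = 0.
  by rewrite -[X in D xi X](scale0r 0) (dual_scale _ _ (hj xi).2) mul0r.
(* The linear part of the tangent vanishes along [u]; it and the gap between [j (u n)] and [m] are
   each allotted [e / 2]. *)
have Dcvg : D xi (u n - xi) @[n --> \oo] --> D xi 0.
  apply: continuous_cvg; first exact: (hj xi).2.2.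
  by rewrite -(subrr xi); apply: cvgB; [exact: u_xi|exact: cvg_cst].
rewrite D0 in Dcvg.
near \oo => n.
have := quadratic_lower_bound hj j_cvx xi (u n).
have : j (u n) < m + e / 2 by near: n; exact: small.
have : `|0 - D xi (u n - xi)| < e / 2 by near: n; exact: cvgr_dist_lt Dcvg _ e2.
rewrite sub0r => /ltr_normlW.
have : 0 <= gamma / 2 * `|u n - xi| ^+ 2.
  by rewrite mulr_ge0 ?exprn_ge0// ltW ?divr_gt0.
lra.
Unshelve. all: by end_near. Qed.

End Minimizer.

(** * Quasi-minimizers over an arbitrary set *)

Section QuasiMinimizer.
Variables (R : realType) (X : normedModType R) (j : X -> R) (xi : X).
Hypothesis mj : minimizer j xi.
Variables (M : set X) (delta : R).

Lemma quasi_minimizer_exists :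
  M !=set0 -> 0 < delta -> exists x, quasi_minimizer j M delta x.
Proof.
move=> [x0 Mx0] d0; have d2 : 0 < delta / 2 by rewrite divr_gt0.
(* Points within [delta / 2] of the extended infimum exist once it is finite: [j xi] bounds it below
   and [j x0] above. *)
have fin : ereal_inf [set (j x)%:E | x in M] \is a fin_num.
  rewrite fin_numElt; apply/andP; split.
    apply: (@lt_le_trans _ _ (j xi)%:E); first exact: ltNyr.
    by apply: le_ereal_inf_tmp => _ [x _ <-]; rewrite lee_fin.
  apply: (@le_lt_trans _ _ (j x0)%:E); last exact: ltry.
  by apply: ereal_inf_lbound; exists x0.
have [_ [x Mx <-] xP] := lb_ereal_inf_adherent d2 fin.
by exists x; split=> //; exact: ltW.
Qed.

Lemma quasi_minimizer_le x y :
  quasi_minimizer j M delta x -> M y -> j x <= j y + delta / 2.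
Proof.
move=> [_ xP] My; rewrite -lee_fin EFinD; apply: le_trans xP _.
by apply: leeD2r; apply: ereal_inf_lbound; exists y.
Qed.

End QuasiMinimizer.

Theorem theorem2 (R : realType) (X : completeNormedModType R)
    (dotp : {dot X for @idfun R}) (hX : induces_norm dotp)
    (j : X -> R) (hj : gateaux_differentiable j)
    (L : R) (L_gt0 : 0 < L)
    (j_lip : forall xi eta : X,
       dual_norm (gateaux_derive j xi \- gateaux_derive j eta)
         <= L * `|xi - eta|)
    (gamma : R) (gamma_gt0 : 0 < gamma)
    (j_cvx : forall xi eta : X,
       gamma * `|xi - eta| ^+ 2
         <= (gateaux_derive j xi \- gateaux_derive j eta) (xi - eta)) :
  exists xibar : X,
    [/\ unique (minimizer j) xibar,
        gateaux_derive j xibar = (fun _ : X => 0),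
        (forall (M : set X) (delta : R), M !=set0 -> 0 < delta ->
           exists xin : X, quasi_minimizer j M delta xin) &
        (forall (M : set X) (delta : R), M !=set0 -> 0 < delta ->
           forall xin : X, quasi_minimizer j M delta xin ->
           `|xibar - xin|
             <= Num.sqrt
                  (L / gamma * inf [set `|xibar - xi| ^+ 2 | xi in M]
                   + delta / gamma))].
Proof.
have [xi mxi] := strongly_convex_minimizer hj gamma_gt0 j_cvx.
have D0 := minimizer_gateaux_derive0 hj L_gt0 j_lip mxi.
have lower x : j xi + gamma / 2 * `|xi - x| ^+ 2 <= j x.
  have := quadratic_lower_bound hj j_cvx xi x.
  by rewrite D0 /= addr0 distrC.
have upper x : j x <= j xi + L / 2 * `|xi - x| ^+ 2.
  have := quadratic_upper_bound hj j_lip xi x.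
  by rewrite D0 /= addr0 distrC.
exists xi; split=> // [|M delta|M delta [x0 Mx0] d0 x qx].
- split=> // x mx; apply/eqP; rewrite -subr_eq0 -normr_eq0 -sqrf_eq0 eq_le.
  rewrite sqr_ge0 andbT -(pmulr_rle0 _ gamma_gt0).
  have := lower x; have := mx xi; lra.
- exact: quasi_minimizer_exists.
- rewrite -[leLHS]ger0_norm// -sqrtr_sqr ler_wsqrtr//.
  (* Isolating the infimum reduces the estimate to a single competitor [y], for which [gamma / 2 *
     |xi - x|^2 <= j x - j xi <= j y - j xi + delta / 2 <= L / 2 * |xi - y|^2 + delta / 2]. *)
  rewrite -lerBlDr -ler_pdivrMl ?divr_gt0//.
  apply: lb_le_inf; first by exists (`|xi - x0| ^+ 2), x0.
  move=> _ [y My <-]; rewrite ler_pdivrMl ?divr_gt0// lerBlDr.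
  rewrite -(ler_pM2l gamma_gt0).
  have -> : gamma * (L / gamma * `|xi - y| ^+ 2 + delta / gamma)
            = L * `|xi - y| ^+ 2 + delta by field; rewrite gt_eqF.
  have := quasi_minimizer_le qx My; have := lower x; have := upper y; lra.
Qed.
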